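(* Let $\{\varepsilon_k\}\subseteq[0,\infty)$ be a null sequence, and let $\{(x^k,\mu^k,\lambda^k)\}$ be a primal-dual sequence generated by the elastically safeguarded augmented Lagrangian algorithm (described in the context) applied to (NLP) such that $\|\nabla_x\mathcal L_{\upsilon_k}(x^k,\hat\mu^k,\hat\lambda^k)\|\le\varepsilon_k$ holds for each $k\in\mathbb N$. Let $\bar x\in\mathbb R^n$ be an accumulation point of $\{x^k\}$ where extended MFCQ is valid, and let $K\subseteq\mathbb N$ be an infinite index set such that the subsequence $\{x^k\}_{k\in K}$ converges to $\bar x$. Then $\{(\mu^k,\lambda^k)\}_{k\in K}$ is bounded. Furthermore, $\bar x$ is stationary for (NLP), and each accumulation point $(\mu,\lambda)$ of $\{(\mu^k,\lambda^k)\}_{k\in K}$ is a multiplier certifying stationarity of $\bar x$.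
   Context: Problem (NLP): minimize $f(x)$ subject to $g(x)\le 0$, $h(x)=0$, where $f\colon\mathbb R^n\to\mathbb R$, $g\colon\mathbb R^n\to\mathbb R^m$, $h\colon\mathbb R^n\to\mathbb R^\ell$ are continuously differentiable. $\|\cdot\|$ is the Euclidean norm; $\max,\min$ of vectors are componentwise; $\mathbb N$ includes $0$; $g'(x)$, $h'(x)$ denote Jacobians. Lagrangian: $L(x,\mu,\lambda)=f(x)+\langle\mu,g(x)\rangle+\langle\lambda,h(x)\rangle$. Augmented Lagrangian for $\upsilon>0$: $\mathcal L_\upsilon(x,\mu,\lambda)=f(x)+\frac1{2\upsilon}\|\max\{0,g(x)+\upsilon\mu\}\|^2+\frac1{2\upsilon}\|h(x)+\upsilon\lambda\|^2$. Elastically safeguarded augmented Lagrangian algorithm. Data: $\upsilon_0>0$; nonempty compact sets $Y^g\subseteq\mathbb R^m$, $Y^h\subseteq\mathbb R^\ell$; $\tau,\gamma\in(0,1)$; $\eta\in(\gamma,\sqrt\gamma)$; tolerances $\varepsilon_k\ge0$. Set $V_{-1}=+\infty$, $\varrho_0=1$. For $k=0,1,2,\dots$ (no termination): (1) select any $\hat\mu^k\in\varrho_kY^g$ and $\hat\lambda^k\in\varrho_kY^h$; (2) find $x^k\in\mathbb R^n$, an $\varepsilon_k$-approximate solution of minimizing $\mathcal L_{\upsilon_k}(\cdot,\hat\mu^k,\hat\lambda^k)$ over $\mathbb R^n$ (the precise sense is the one specified in the claim); (3) set $z^k=\min\{0,g(x^k)+\upsilon_k\hat\mu^k\}$ and $V_k=\max\{\|g(x^k)-z^k\|,\|h(x^k)\|\}$;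 (4) set $\mu^k=\hat\mu^k+[g(x^k)-z^k]/\upsilon_k$ and $\lambda^k=\hat\lambda^k+h(x^k)/\upsilon_k$; (5) if $V_k\le\tau V_{k-1}$, set $\upsilon_{k+1}=\upsilon_k$, $\varrho_{k+1}=\varrho_k$; otherwise set $\upsilon_{k+1}=\gamma\upsilon_k$, $\varrho_{k+1}=\eta\varrho_k/\gamma$. Stationarity: a feasible point $x$ of (NLP) is stationary if there exist $\mu\in\mathbb R^m$, $\lambda\in\mathbb R^\ell$ with $\nabla_xL(x,\mu,\lambda)=0$, $\mu\ge0$, $\mu^\top g(x)=0$; such $(\mu,\lambda)$ is called a multiplier certifying stationarity of $x$. Extended MFCQ holds at a (not necessarily feasible) point $\bar x\in\mathbb R^n$ if there is no $(\mu,\lambda)\in\mathbb R^m\times\mathbb R^\ell$ with $(\mu,\lambda)\ne(0,0)$ such that $g'(\bar x)^\top\mu+h'(\bar x)^\top\lambda=0$, $\mu\ge0$, $\mu^\top\min\{0,g(\bar x)\}=0$. *)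

(* Defs.v *)
From HB Require Import structures.
From mathcomp Require Import all_boot all_order all_algebra.
From mathcomp Require Import all_classical all_reals all_analysis.
Set Implicit Arguments.
Unset Strict Implicit.
Unset Printing Implicit Defensive.
Import Order.TTheory GRing.Theory Num.Theory.
Import numFieldNormedType.Exports.
Local Open Scope classical_set_scope.
Local Open Scope ring_scope.

(* Vectors of R^n are row vectors. The library norm on 'rV[R]_n is the
   sup-norm, hence the separate Euclidean norm [enorm]; the topology is the
   same for both. *)
Definition dot (R : realType) (n : nat) (u v : 'rV[R]_n) : R :=
  \sum_(i < n) u 0 i * v 0 i.

Definition enorm (R : realType) (n : nat) (u : 'rV[R]_n) : R :=
  Num.sqrt (dot u u).

Definition max0 (R : realType) (n : nat) (u : 'rV[R]_n) : 'rV[R]_n :=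
  map_mx (Num.max 0) u.

Definition min0 (R : realType) (n : nat) (u : 'rV[R]_n) : 'rV[R]_n :=
  map_mx (Num.min 0) u.

Definition gradient (R : realType) (n : nat) (f : 'rV[R]_n -> R)
    (x : 'rV[R]_n) : 'rV[R]_n :=
  \row_(i < n) 'd f x (delta_mx 0 i).

(* The library's ['J F x] satisfies ['d F x v = v *m 'J F x], so the usual
   m x n Jacobian F'(x) is its transpose. With row vectors, F'(x)^T mu is
   written [mu *m jac F x]. *)
Definition jac (R : realType) (n m : nat) (F : 'rV[R]_n -> 'rV[R]_m)
    (x : 'rV[R]_n) : 'M[R]_(m, n) :=
  ('J F x)^T.

Definition C1_fun (R : realType) (n : nat) (f : 'rV[R]_n -> R) : Prop :=
  (forall x, differentiable f x) /\ continuous (gradient f).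

Definition C1_map (R : realType) (n m : nat) (F : 'rV[R]_n -> 'rV[R]_m) : Prop :=
  (forall x, differentiable F x) /\ continuous (jac F).

Definition lagrangian (R : realType) (n m l : nat) (f : 'rV[R]_n -> R)
    (g : 'rV[R]_n -> 'rV[R]_m) (h : 'rV[R]_n -> 'rV[R]_l)
    (x : 'rV[R]_n) (mu : 'rV[R]_m) (lam : 'rV[R]_l) : R :=
  f x + dot mu (g x) + dot lam (h x).

Definition aug_lagrangian (R : realType) (n m l : nat) (f : 'rV[R]_n -> R)
    (g : 'rV[R]_n -> 'rV[R]_m) (h : 'rV[R]_n -> 'rV[R]_l)
    (ups : R) (x : 'rV[R]_n) (mu : 'rV[R]_m) (lam : 'rV[R]_l) : R :=
  f x + (2 * ups)^-1 * enorm (max0 (g x + ups *: mu)) ^+ 2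
      + (2 * ups)^-1 * enorm (h x + ups *: lam) ^+ 2.

Definition feasible (R : realType) (n m l : nat)
    (g : 'rV[R]_n -> 'rV[R]_m) (h : 'rV[R]_n -> 'rV[R]_l)
    (x : 'rV[R]_n) : Prop :=
  (forall i, g x 0 i <= 0) /\ h x = 0.

Definition is_multiplier (R : realType) (n m l : nat) (f : 'rV[R]_n -> R)
    (g : 'rV[R]_n -> 'rV[R]_m) (h : 'rV[R]_n -> 'rV[R]_l)
    (x : 'rV[R]_n) (mu : 'rV[R]_m) (lam : 'rV[R]_l) : Prop :=
  [/\ gradient (fun y => lagrangian f g h y mu lam) x = 0,
      forall i, 0 <= mu 0 i
    & dot mu (g x) = 0].

Definition stationary (R : realType) (n m l : nat) (f : 'rV[R]_n -> R)
    (g : 'rV[R]_n -> 'rV[R]_m) (h : 'rV[R]_n -> 'rV[R]_l)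
    (x : 'rV[R]_n) : Prop :=
  feasible g h x /\ exists mu lam, is_multiplier f g h x mu lam.

Definition extended_MFCQ (R : realType) (n m l : nat)
    (g : 'rV[R]_n -> 'rV[R]_m) (h : 'rV[R]_n -> 'rV[R]_l)
    (x : 'rV[R]_n) : Prop :=
  ~ exists mu lam,
      [/\ (mu, lam) <> (0, 0),
          mu *m jac g x + lam *m jac h x = 0,
          forall i, 0 <= mu 0 i
        & dot mu (min0 (g x)) = 0].

(* [V_(k-1)], with the convention V_(-1) = +oo. *)
Definition prevV (R : realType) (V : nat -> R) (k : nat) : \bar R :=
  if k is k'.+1 then (V k')%:E else +oo%E.

Record safeguard_params (R : realType) (m l : nat) (ups0 : R)
    (Yg : set 'rV[R]_m) (Yh : set 'rV[R]_l) (tau gamma eta : R) : Prop := {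
  params_ups0 : 0 < ups0;
  params_Yg : Yg !=set0 /\ compact Yg;
  params_Yh : Yh !=set0 /\ compact Yh;
  params_tau : 0 < tau < 1;
  params_gamma : 0 < gamma < 1;
  params_eta : gamma < eta < Num.sqrt gamma
}.

(* No condition ties [x k] to the k-th subproblem, minimizing the augmented
   Lagrangian for [ups k], [hmu k], [hlam k]: the sense in which [x k] solves it
   approximately is a separate requirement. *)
Record safeguarded_AL_run (R : realType) (n m l : nat)
    (g : 'rV[R]_n -> 'rV[R]_m) (h : 'rV[R]_n -> 'rV[R]_l) (ups0 : R)
    (Yg : set 'rV[R]_m) (Yh : set 'rV[R]_l) (tau gamma eta : R)
    (ups rho V : nat -> R) (x : nat -> 'rV[R]_n)
    (hmu mu z : nat -> 'rV[R]_m) (hlam lam : nat -> 'rV[R]_l) : Prop := {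
  run_ups0 : ups 0%N = ups0;
  run_rho0 : rho 0%N = 1;
  run_hmu : forall k, [set rho k *: y | y in Yg] (hmu k);
  run_hlam : forall k, [set rho k *: y | y in Yh] (hlam k);
  run_z : forall k, z k = min0 (g (x k) + ups k *: hmu k);
  run_V : forall k, V k = Num.max (enorm (g (x k) - z k)) (enorm (h (x k)));
  run_mu : forall k, mu k = hmu k + (ups k)^-1 *: (g (x k) - z k);
  run_lam : forall k, lam k = hlam k + (ups k)^-1 *: h (x k);
  run_keep : forall k, ((V k)%:E <= tau%:E * prevV V k)%E ->
    ups k.+1 = ups k /\ rho k.+1 = rho k;
  run_update : forall k, ~ ((V k)%:E <= tau%:E * prevV V k)%E ->
    ups k.+1 = gamma * ups k /\ rho k.+1 = eta * rho k / gamma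
}.

(* Main.v *)
(* The gradient of the augmented Lagrangian at [x k] equals the gradient of the
   Lagrangian at [(x k, mu k, lam k)]. Along [K], the multipliers of the
   constraints inactive at [xbar] eventually vanish: either [V] tends to 0, or
   [ups] and [ups * rho] do. If the multipliers were unbounded along [K],
   dividing the gradient relation by their norm would give in the limit a
   nonzero pair violating extended MFCQ. Boundedness then forces feasibility of
   [xbar] (in the second case [g (x k) - z k = ups k *: (mu k - hmu k)] tends to
   0), and the gradient relation passes to the limit. Subsequences are represented by
   proper filters on the indices that refine [within K \oo]. *)
Require Import Defs.
From HB Require Import structures.
From mathcomp Require Import all_boot all_order all_algebra.
From mathcomp Require Import all_classical all_reals all_analysis.
From mathcomp Require Import ring lra.
Set Implicit Arguments.
Unset Strict Implicit.
Unset Printing Implicit Defensive.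
Import Order.TTheory GRing.Theory Num.Theory.
Import numFieldNormedType.Exports.
Local Open Scope classical_set_scope.
Local Open Scope ring_scope.

(** * Gradients of the Lagrangian and of the augmented Lagrangian *)

(* A global quadratic error bound replaces the case analysis at the kink of
   max(0, .)^2. *)
Lemma is_diff_quadratic (R : realType) (phi : R -> R) (t c : R) :
  (forall s, `|phi (t + s) - phi t - c * s| <= s ^+ 2) ->
  is_diff t phi (fun v => c * v).
Proof.
move=> phiP.
have dphi : (fun s => s^-1 *: ((phi \o shift t) (s *: 1) - phi t)) @ 0^' --> c.
  apply/cvgrPdist_le => e e0; near=> s.
  have s0 : s != 0 by near: s; exact: nbhs_dnbhs_neq.
  have se : `|s| <= e.
    by near: s; apply: dnbhs0_le.
  rewrite /= scaler1 (addrC s) distrC.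
  have -> : s^-1 *: (phi (t + s) - phi t) - c =
      s^-1 * (phi (t + s) - phi t - c * s).
    by rewrite /GRing.scale/=; field.
  rewrite normrM normfV mulrC ler_pdivrMr ?normr_gt0//.
  apply: le_trans (phiP s) _.
  by rewrite -real_normK ?num_real// expr2 ler_wpM2r.
have ex : derivable phi t 1 by apply/cvg_ex; exists c.
have df : differentiable phi t by apply/derivable1_diffP.
apply: DiffDef => //.
have Dphi : 'D_1 phi t = c by exact: cvg_lim dphi.
rewrite diff1E//; apply/funext => v; rewrite derive1E Dphi.
by rewrite /GRing.scale/= mulrC.
Unshelve. all: by end_near. Qed.

Lemma is_diff_shift_sqr (R : realType) (a t : R) :
  is_diff t (fun s => (s + a) ^+ 2) (fun v => 2 * (t + a) * v).
Proof.
apply: is_diff_quadratic => s.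
rewrite (_ : _ - _ = s ^+ 2); last by ring.
by rewrite ger0_norm ?sqr_ge0.
Qed.

(** The derivative [2 * Num.max 0 (s + a)] is 2-Lipschitz in [s], which gives the quadratic bound
    with constant 1, whatever the signs at the two points. *)
Lemma is_diff_shift_max0_sqr (R : realType) (a t : R) :
  is_diff t (fun s => Num.max 0 (s + a) ^+ 2)
    (fun v => 2 * Num.max 0 (t + a) * v).
Proof.
apply: is_diff_quadratic => s.
rewrite ler_norml; case: (leP 0 (t + a)) => h1; case: (leP 0 (t + s + a)) => h2;
  apply/andP; split; nra.
Qed.

Lemma is_diff_mull (R : realType) (a t : R) :
  is_diff t (fun s => a * s) (fun v => a * v).
Proof.
apply: is_diff_quadratic => s.
by rewrite (_ : _ - _ = 0) ?normr0 ?sqr_ge0//; ring.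
Qed.

(** Constraints enter both Lagrangians only through sums of scalar functions of single coordinates.
    The chain rule then collects the scalar derivatives in one weight vector [c] acting on the
    Jacobian. *)
Lemma is_diff_sum_comp_coord (R : realType) (n m : nat)
    (F : 'rV[R]_n -> 'rV[R]_m) (x : 'rV[R]_n) (phi : 'I_m -> R -> R)
    (c : 'rV[R]_m) :
  differentiable F x ->
  (forall j, is_diff (F x 0 j) (phi j) (fun v => c 0 j * v)) ->
  is_diff x (fun y => \sum_j phi j (F y 0 j))
    (fun v => (c *m jac F x *m v^T) 0 0).
Proof.
move=> dF dphi.
have dFj j : is_diff x (fun y => F y 0 j) (fun v => 'd F x v 0 j).
  (* Evaluation of a coordinate is packaged as a linear map, so that it is its own differential. *)
  have @co : {linear 'rV[R]_m -> R}.
    by exists (fun N : 'rV[R]_m => N 0 j); do 2![eexists]; do ?[constructor];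
     rewrite ?mxE// => ? *; rewrite ?mxE//; move=> ?; rewrite !mxE.
  have cco : continuous co by exact: coord_continuous.
  have dco : is_diff (F x) co co.
    by apply: DiffDef; [exact: linear_differentiable|rewrite diff_lin].
  exact: (is_diff_comp (differentiableP dF) dco).
have dj j : is_diff x (phi j \o (fun y => F y 0 j))
    ((fun v => c 0 j * v) \o (fun v => 'd F x v 0 j)).
  exact: is_diff_comp.
have -> : (fun y => \sum_j phi j (F y 0 j)) =
    \sum_j (phi j \o (fun y => F y 0 j)).
  by apply/funext => y; rewrite fct_sumE.
have -> : (fun v => (c *m jac F x *m v^T) 0 0) =
    \sum_j ((fun v => c 0 j * v) \o (fun v => 'd F x v 0 j)).
  apply/funext => v; rewrite fct_sumE -mulmxA mxE; apply: eq_bigr => j _ /=.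
  congr (_ * _); rewrite -(mul_rV_lin1 ('d F x)) -/(jacobian F x) /jac.
  by rewrite -trmx_mul mxE.
elim/big_ind2 : _ => //; first exact: is_diff_cst.
by move=> f1 g1 f2 g2 ? ?; exact: is_diffD.
Qed.

Lemma gradient_is_diff (R : realType) (n : nat) (f : 'rV[R]_n -> R)
    (x u : 'rV[R]_n) :
  is_diff x f (fun v => (u *m v^T) 0 0) -> gradient f x = u.
Proof.
move=> fu; apply/rowP => i; rewrite mxE (@diff_val _ _ _ _ _ _ _ fu).
rewrite mxE (bigD1 i)//= big1 ?addr0 ?mxE ?eqxx ?mulr1//.
by move=> j ji; rewrite !mxE (negbTE ji) mulr0.
Qed.

Lemma is_diff_gradient (R : realType) (n : nat) (f : 'rV[R]_n -> R)
    (x : 'rV[R]_n) :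
  differentiable f x -> is_diff x f (fun v => (gradient f x *m v^T) 0 0).
Proof.
move=> df; apply: (is_diff_eq (differentiableP df)); apply/funext => v.
rewrite mxE {1}(row_sum_delta v) linear_sum/=; apply: eq_bigr => i _.
by rewrite !mxE linearZ/= mulrC.
Qed.

(** Common template: linear [phi], [psi] with [a = 1] give the Lagrangian, squares with
    [a = (2 * ups)^-1] the augmented Lagrangian. *)
Lemma gradient_add_sums (R : realType) (n m l : nat) (f : 'rV[R]_n -> R)
    (g : 'rV[R]_n -> 'rV[R]_m) (h : 'rV[R]_n -> 'rV[R]_l) (x : 'rV[R]_n)
    (a : R) (phi : 'I_m -> R -> R) (psi : 'I_l -> R -> R)
    (c : 'rV[R]_m) (d : 'rV[R]_l) :
  differentiable f x -> differentiable g x -> differentiable h x ->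
  (forall j, is_diff (g x 0 j) (phi j) (fun v => c 0 j * v)) ->
  (forall j, is_diff (h x 0 j) (psi j) (fun v => d 0 j * v)) ->
  gradient (fun y => f y + a * (\sum_j phi j (g y 0 j))
                         + a * (\sum_j psi j (h y 0 j))) x =
  gradient f x + a *: (c *m jac g x) + a *: (d *m jac h x).
Proof.
move=> df dg dh dphi dpsi; apply: gradient_is_diff.
have dG := is_diff_sum_comp_coord dg dphi.
have dH := is_diff_sum_comp_coord dh dpsi.
have /is_diff_eq := is_diffD
  (is_diffD (is_diff_gradient df) (is_diffZ a dG)) (is_diffZ a dH).
apply; apply/funext => v.
rewrite !mulmxDl -!scalemxAl [RHS]mxE [X in _ = X + _]mxE.
by rewrite ![(_ *: (_ *m _))%R _ _]mxE.
Qed.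

Lemma sqr_enorm (R : realType) (n : nat) (u : 'rV[R]_n) :
  enorm u ^+ 2 = \sum_i u 0 i ^+ 2.
Proof.
rewrite sqr_sqrtr; first by apply: eq_bigr => i _; rewrite expr2.
by apply: sumr_ge0 => i _; rewrite -expr2 sqr_ge0.
Qed.

(** Turns the Euclidean bounds given by [V] and [eps] into coordinatewise ones, which suffice for
    the topology of the sup-norm. *)
Lemma coord_le_enorm (R : realType) (n : nat) (u : 'rV[R]_n) i :
  `|u 0 i| <= enorm u.
Proof.
rewrite -(@ler_pXn2r _ 2) ?nnegrE ?sqrtr_ge0// sqr_enorm (bigD1 i)//=.
by rewrite real_normK ?num_real// lerDl sumr_ge0// => j _; rewrite sqr_ge0.
Qed.

Lemma gradient_lagrangian (R : realType) (n m l : nat) (f : 'rV[R]_n -> R)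
    (g : 'rV[R]_n -> 'rV[R]_m) (h : 'rV[R]_n -> 'rV[R]_l) (x : 'rV[R]_n)
    (mu : 'rV[R]_m) (lam : 'rV[R]_l) :
  differentiable f x -> differentiable g x -> differentiable h x ->
  gradient (fun y => lagrangian f g h y mu lam) x =
  gradient f x + mu *m jac g x + lam *m jac h x.
Proof.
move=> df dg dh.
have := @gradient_add_sums _ _ _ _ f g h x 1 (fun j s => mu 0 j * s)
  (fun j s => lam 0 j * s) mu lam df dg dh (fun j => is_diff_mull _ _)
  (fun j => is_diff_mull _ _).
rewrite !scale1r => <-; congr gradient; apply/funext => y.
by rewrite /lagrangian /dot !mul1r.
Qed.

Lemma gradient_aug_lagrangian (R : realType) (n m l : nat) (f : 'rV[R]_n -> R)
    (g : 'rV[R]_n -> 'rV[R]_m) (h : 'rV[R]_n -> 'rV[R]_l) (ups : R)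
    (x : 'rV[R]_n) (mu : 'rV[R]_m) (lam : 'rV[R]_l) :
  differentiable f x -> differentiable g x -> differentiable h x ->
  gradient (fun y => aug_lagrangian f g h ups y mu lam) x =
  gradient f x + (ups^-1 *: max0 (g x + ups *: mu)) *m jac g x
               + (ups^-1 *: (h x + ups *: lam)) *m jac h x.
Proof.
move=> df dg dh.
have := @gradient_add_sums _ _ _ _ f g h x (2 * ups)^-1
  (fun j s => Num.max 0 (s + ups * mu 0 j) ^+ 2)
  (fun j s => (s + ups * lam 0 j) ^+ 2)
  (2 *: max0 (g x + ups *: mu)) (2 *: (h x + ups *: lam)) df dg dh.
(* The 2 produced by differentiating the squares cancels against the penalty factor. *)
have twoV : (2 * ups)^-1 * 2 = ups^-1 :> R.
  by rewrite invfM mulrAC mulVf ?mul1r// pnatr_eq0.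
rewrite -!scalemxAl !scalerA twoV => gradE; apply: etrans (gradE _ _).
- congr gradient; apply/funext => y; rewrite /aug_lagrangian !sqr_enorm.
  by congr (_ + _ * _ + _ * _); apply: eq_bigr => j _; rewrite !mxE.
- by move=> j; rewrite !mxE; exact: is_diff_shift_max0_sqr.
- by move=> j; rewrite !mxE; exact: is_diff_shift_sqr.
Qed.

(** * Null sequences, and filters in the role of subsequences *)

(** The limit [L] lies below every term. After any [k] some contracting step occurs, so
    [L <= c * s k]; in the limit [L <= c * L], which forces [L = 0]. It serves for [V], [ups] and
    [ups * rho], with factors [tau], [gamma] and [eta]. *)
Lemma nonincreasing_contracting_cvg0 (R : realType) (s : nat -> R) (c : R) :
  0 <= c -> c < 1 -> (forall k, 0 <= s k) -> (forall k, s k.+1 <= s k) ->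
  (forall N, exists2 k, (N <= k)%N & s k.+1 <= c * s k) ->
  s k @[k --> \oo] --> 0.
Proof.
move=> c0 c1 s0 s_dec s_contr.
have s_ni : nonincreasing_seq s by exact/nonincreasing_seqP.
have s_lb : has_lbound (range s) by exists 0 => _ [k _ <-].
have sL := nonincreasing_cvgn s_ni s_lb; set L := inf _ in sL.
have L0 : 0 <= L.
  by apply: lb_le_inf => [|_ [k _ <-]]; first by exists (s 0), 0%N.
have LcsL k : L <= c * s k.
  have [j kj sj] := s_contr k.
  have Lj : L <= s j.+1 by apply: ge_inf => //; exists j.+1.
  apply: le_trans Lj _; apply: le_trans sj _.
  by rewrite ler_wpM2l// s_ni.
have LcL : L <= c * L.
  by apply: (ler_cvg_to (cvg_cst L) (cvgMl_tmp sL)); apply: nearW.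
have -> // : 0 = L by apply/eqP; rewrite eq_le L0 /=; nra.
Qed.

Lemma within_infinite_proper (K : set nat) :
  infinite_set K -> ProperFilter (within K \oo).
Proof.
move=> Kinf; apply: Build_ProperFilter_ex => P [N _ NP].
apply: contrapT => P0; apply: Kinf.
apply: (@sub_finite_set _ _ `I_N); last exact: finite_II.
move=> k Kk /=; rewrite ltnNge; apply/negP => Nk.
by apply: P0; exists k; exact: NP.
Qed.

(** Filter form of extracting a convergent subsequence: [G] is generated by the sets of indices in
    some [A] of [F] that [p] sends into a neighbourhood of [q]. The cluster property says exactly
    that none of them is empty. *)
Lemma cluster_comp (I : Type) (T : topologicalType) (F : set_system I)
    (p : I -> T) (q : T) :
  ProperFilter F -> cluster (p i @[i --> F]) q ->
  exists G : set_system I,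
    [/\ ProperFilter G, F `<=` G & p i @[i --> G] --> q].
Proof.
move=> FF clq.
pose D := [set AB : set I * set T | F AB.1 /\ nbhs q AB.2].
pose B (AB : set I * set T) := AB.1 `&` p @^-1` AB.2.
exists (filter_from D B); split.
- apply: filter_from_proper.
    apply: filter_from_filter.
      by exists (setT, setT); split => /=; exact: filterT.
    move=> [A1 B1] [A2 B2] [/= FA1 qB1] [/= FA2 qB2].
    exists (A1 `&` A2, B1 `&` B2); first by split => /=; exact: filterI.
    by move=> i [[/= ? ?] [/= ? ?]]; split.
  move=> [A1 B1] [/= FA1 qB1].
  have pA1 : (p i @[i --> F]) (p @` A1).
    by apply: (@filterS _ F) FA1 => i Ai; exists i.
  have [_ [[i Ai <-] Bi]] := clq _ _ pA1 qB1.
  by exists i.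
- move=> A FA; exists (A, setT); first by split => //=; exact: filterT.
  by move=> i [].
- move=> C qC; exists (setT, C); first by split => //=; exact: filterT.
  by move=> i [].
Qed.

(** Bolzano-Weierstrass for filters: the closed ball of radius [M] is compact, so the image filter
    has a cluster point. *)
Lemma bounded_subfilter_cvg (I : Type) (R : realType) (n : nat)
    (F : set_system I) (p : I -> 'rV[R]_n) (M : R) :
  ProperFilter F -> (\forall i \near F, `|p i| <= M) ->
  exists G (v : 'rV[R]_n),
    [/\ ProperFilter G, F `<=` G & p i @[i --> G] --> v].
Proof.
move=> FF pM.
pose A := [set v : 'rV[R]_n | `|v| <= M].
have Ac : compact A.
  apply: bounded_closed_compact; last first.
    by apply: closed_comp (@closed_le _ M) => v _; exact: norm_continuous.
  exists M; split; first exact: num_real.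
  by move=> N MN v Av; apply: le_trans (ltW MN).
have [v [_ clv]] := Ac (p i @[i --> F]) _ pM.
by have [G [? ? ?]] := cluster_comp FF clv; exists G, v.
Qed.

(** [F] is the image of [\oo] under a choice of indices [phi j] in [K] with [j <= phi j] and
    [j%:R < t (phi j)]; [phi] may fail to be increasing. *)
Lemma unbounded_subsequence (R : realType) (t : nat -> R) (K : set nat) :
  (forall M, exists2 k, K k & M < t k) ->
  exists F : set_system nat, [/\ ProperFilter F, within K \oo `<=` F &
    forall M, \forall k \near F, M < t k].
Proof.
move=> tK.
have /choice[phi phiP] N : exists k, [/\ K k, (N <= k)%N & N%:R < t k].
  (* This threshold is at least every [t i] with [i < N], so exceeding it forces [N <= k]. *)
  have [k Kk tk] := tK (N%:R + \sum_(i < N) `|t i|).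
  have sum0 : 0 <= \sum_(i < N) `|t i| by exact: sumr_ge0.
  exists k; split => //; last by apply: le_lt_trans tk; rewrite lerDl.
  rewrite leqNgt; apply/negP => kN.
  have := ler_norm (t k); rewrite leNgt => /negP; apply; apply: le_lt_trans tk.
  rewrite (bigD1 (Ordinal kN))//= addrCA lerDl addr_ge0//.
  by apply: sumr_ge0.
exists (phi k @[k --> \oo]); split.
- exact: fmap_proper_filter.
- move=> P [N _ NP]; exists N => // j Nj /=; have [Kj jphi _] := phiP j.
  by apply: NP => //=; exact: leq_trans jphi.
- move=> M; suff : \forall j \near \oo, M < t (phi j) by [].
  near=> j; have [_ _] := phiP j; apply: lt_trans.
  near: j; exact: nbhs_infty_gtr.
Unshelve. all: by end_near. Qed.

(** * Limits of vectors and matrices along a filter *)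

Lemma cvg_coord (I : Type) (R : realType) (m n : nat) (F : set_system I)
    {FF : Filter F} (A : I -> 'M[R]_(m, n)) (a : 'M[R]_(m, n)) i j :
  A k @[k --> F] --> a -> A k i j @[k --> F] --> a i j.
Proof.
move=> Aa; apply: (@cvg_comp _ _ _ A (fun M : 'M[R]_(m, n) => M i j)) Aa _.
exact: coord_continuous.
Qed.
Arguments cvg_coord {I R m n F FF A a} i j.

Lemma cvg_mx (I : Type) (R : realType) (m n : nat) (F : set_system I)
    (A : I -> 'M[R]_(m, n)) (a : 'M[R]_(m, n)) :
  Filter F -> (forall i j, A k i j @[k --> F] --> a i j) ->
  A k @[k --> F] --> a.
Proof.
move=> FF Aa; apply/cvgrPdist_le => e e0; near=> k.
rewrite [leLHS]/Num.Def.normr/= mx_normrE (bigmax_le _ (ltW e0))//= => i _.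
rewrite !mxE; move: i; near: k; apply: filter_forall => i.
by have /cvgrPdist_le/(_ _ e0) := Aa i.1 i.2.
Unshelve. all: by end_near. Qed.

Lemma cvg_mulmx (I : Type) (R : realType) (m n p : nat) (F : set_system I)
    (A : I -> 'M[R]_(m, n)) (B : I -> 'M[R]_(n, p)) (a : 'M[R]_(m, n))
    (b : 'M[R]_(n, p)) :
  Filter F -> A k @[k --> F] --> a -> B k @[k --> F] --> b ->
  A k *m B k @[k --> F] --> a *m b.
Proof.
move=> FF Aa Bb; apply: cvg_mx => i j.
rewrite mxE (_ : (fun k => (A k *m B k) i j) =
  \sum_r (fun k => A k i r * B k r j)); last first.
  by apply/funext => k; rewrite mxE fct_sumE.
elim/big_ind2 : _ => [|u u' v v' uu' vv'|r _]; first exact: cvg_cst.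
  exact: cvgD.
by apply: cvgM; exact: cvg_coord.
Qed.

(** Elements of the compact set have norm at most [M + 1], so the scaled vectors are dominated by
    [(M + 1)] times [|s k * r k|]. It is used with [s = ups] and [r = rho]. *)
Lemma scale_bounded_cvg0 (R : realType) (d : nat) (Y : set 'rV[R]_d)
    (s r : nat -> R) (v : nat -> 'rV[R]_d) :
  compact Y -> (forall k, [set r k *: y | y in Y] (v k)) ->
  s k * r k @[k --> \oo] --> 0 -> s k *: v k @[k --> \oo] --> (0 : 'rV[R]_d).
Proof.
move=> /compact_bounded[M [Mreal YM]] vY sr0.
apply: norm_cvg0.
have srM0 : `|s k * r k| * (M + 1) @[k --> \oo] --> 0.
  by have := cvgM (cvg_norm sr0) (cvg_cst (M + 1)); rewrite normr0 mul0r; exact.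
apply: (squeeze_cvgr _ (cvg_cst 0) srM0); apply: nearW => k.
rewrite normr_ge0/=; have [y Yy <-] := vY k.
rewrite scalerA normrZ ler_wpM2l//; apply: (YM (M + 1)) => //.
by rewrite ltrDl.
Qed.

(** * Consequences of the update rules of the algorithm *)

Section SafeguardedRun.
Context (R : realType) (n m l : nat)
  (g : 'rV[R]_n -> 'rV[R]_m) (h : 'rV[R]_n -> 'rV[R]_l) (ups0 : R)
  (Yg : set 'rV[R]_m) (Yh : set 'rV[R]_l) (tau gamma eta : R)
  (ups rho V : nat -> R) (x : nat -> 'rV[R]_n)
  (hmu mu z : nat -> 'rV[R]_m) (hlam lam : nat -> 'rV[R]_l).
Context (params : safeguard_params ups0 Yg Yh tau gamma eta).
Context (run : safeguarded_AL_run g h ups0 Yg Yh tau gamma eta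
             ups rho V x hmu mu z hlam lam).

Lemma run_gt0 k : 0 < ups k /\ 0 < rho k.
Proof.
have [u0 _ _ _ /andP[g0 _] /andP[ge _]] := params; elim: k => [|k [uk rk]].
  by rewrite (run_ups0 run) (run_rho0 run).
have e0 := lt_trans g0 ge.
have [/(run_keep run)[-> ->]//|/(run_update run)[-> ->]] :=
  pselect ((V k)%:E <= tau%:E * prevV V k)%E.
by rewrite !mulr_gt0// ?invr_gt0.
Qed.

(* Infinitely many updates shrink [ups * rho] by the factor [eta < 1] each, so
   the safeguarded multipliers, of size O(rho), are negligible against
   [1 / ups]; otherwise the test eventually always succeeds and [V] decays
   geometrically. *)
Lemma run_dichotomy :
  V k @[k --> \oo] --> 0 \/
  [/\ ups k @[k --> \oo] --> 0, ups k *: hmu k @[k --> \oo] --> (0 : 'rV[R]_m)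
    & ups k *: hlam k @[k --> \oo] --> (0 : 'rV[R]_l)].
Proof.
have [u0 [_ cYg] [_ cYh] /andP[t0 t1] /andP[g0 g1] /andP[ge es]] := params.
have pos := run_gt0.
have e0 := lt_trans g0 ge.
have e1 : eta < 1.
  by apply: lt_trans es _; rewrite -[X in _ < X]sqrtr1 ltr_sqrt.
pose keep k := ((V k)%:E <= tau%:E * prevV V k)%E.
have [[N NP]|noN] := pselect (exists N, forall k, (N <= k)%N -> keep k).
  (* Past [N] every test succeeds. The test at [k.+1 + N] compares with the real number [V (k + N)],
     so the value [+oo] of [prevV] at 0 never enters. *)
  left; rewrite -(cvg_shiftn N).
  have V0 k : 0 <= V k by rewrite (run_V run) le_max sqrtr_ge0.
  have Vt k : V (k.+1 + N)%N <= tau * V (k + N)%N.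
    by have := NP (k.+1 + N)%N (leq_addl _ _); rewrite /keep /= -EFinM lee_fin.
  apply: (nonincreasing_contracting_cvg0 (ltW t0) t1) => // [k|N'].
    by apply: le_trans (Vt k) _; rewrite ler_piMl// ltW.
  by exists N'.
have oft N : exists2 k, (N <= k)%N & ~ keep k.
  apply: contrapT => H; apply: noN; exists N => k Nk.
  by apply: contrapT => nk; apply: H; exists k.
right.
have ups_cvg : ups k @[k --> \oo] --> 0.
  apply: (nonincreasing_contracting_cvg0 (ltW g0) g1) => [k|k|N].
  - by have [/ltW] := pos k.
  - have [uk _] := pos k.
    have [/(run_keep run)[-> _]//|/(run_update run)[-> _]] := pselect (keep k).
    by rewrite ler_piMl// ltW.
  - by have [k Nk nk] := oft N; exists k => //; rewrite (run_update run nk).1.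
have upsrho_cvg : ups k * rho k @[k --> \oo] --> 0.
  have upd k : ~ keep k -> ups k.+1 * rho k.+1 = eta * (ups k * rho k).
    move=> /(run_update run)[-> ->].
    by field; rewrite gt_eqF.
  apply: (nonincreasing_contracting_cvg0 (ltW e0) e1) => [k|k|N].
  - by have [uk rk] := pos k; rewrite mulr_ge0// ltW.
  - have [uk rk] := pos k.
    have [/(run_keep run)[-> ->]//|/upd ->] := pselect (keep k).
    by rewrite ler_piMl ?mulr_ge0// ltW.
  - by have [k Nk /upd ukk] := oft N; exists k => //; rewrite ukk.
split => //.
- exact: scale_bounded_cvg0 cYg (run_hmu run) upsrho_cvg.
- exact: scale_bounded_cvg0 cYh (run_hlam run) upsrho_cvg.
Qed.

(** Since [t - min(0, t) = max(0, t)], the multiplier update yields the coefficient of the Jacobian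
    of [g] in the gradient of the augmented Lagrangian. This form also shows that [mu k] is
    nonnegative. *)
Lemma run_muE k : mu k = (ups k)^-1 *: max0 (g (x k) + ups k *: hmu k).
Proof.
have [uk _] := run_gt0 k.
have uk0 : ups k != 0 by rewrite gt_eqF.
rewrite (run_mu run) (run_z run); apply/rowP => i; rewrite !mxE.
have [t0|t0] := leP 0 (g (x k) 0 i + ups k * hmu k 0 i).
  by field.
by field.
Qed.

Lemma run_lamE k : lam k = (ups k)^-1 *: (h (x k) + ups k *: hlam k).
Proof.
have [uk _] := run_gt0 k.
by rewrite (run_lam run) scalerDr scalerA mulVf ?gt_eqF// scale1r addrC.
Qed.

Lemma inactive_multiplier_eq0
    (F : set_system nat) (xbar : 'rV[R]_n) (i : 'I_m) :
  Filter F -> F `=>` \oo -> g (x k) @[k --> F] --> g xbar ->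
  g xbar 0 i < 0 -> \forall k \near F, mu k 0 i = 0.
Proof.
move=> FF Foo gx gi0.
have gxi : g (x k) 0 i @[k --> F] --> g xbar 0 i by exact: cvg_coord.
suff : \forall k \near F, g (x k) 0 i + ups k * hmu k 0 i <= 0.
  by apply: filterS => k tk; rewrite run_muE !mxE max_l// mulr0.
have [V0|[_ uh0 _]] := run_dichotomy.
  (* If the sum were positive, the coordinate of [z k] would be 0, hence the absolute value of that
     coordinate of [g (x k)] would be at most [V k]. Half of the negative limit value separates the
     two. *)
  near=> k; rewrite leNgt; apply/negP => tk.
  have gk : g (x k) 0 i < g xbar 0 i / 2.
    by near: k; apply: (cvgr_lt _ gxi); lra.
  have Vk : V k < - (g xbar 0 i / 2).
    by near: k; apply: Foo; apply: (cvgr_lt _ V0); lra.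
  have := coord_le_enorm (g (x k) - z k) i.
  rewrite (run_z run) !mxE min_l ?(ltW tk)// subr0.
  have : enorm (g (x k) - z k) <= V k by rewrite (run_V run) le_max lexx.
  rewrite (run_z run) ler0_norm; last lra.
  lra.
(* In the other case the shift vanishes, and the sum itself tends to a negative number. *)
have sum_cvg : g (x k) 0 i + (ups k *: hmu k) 0 i @[k --> F] -->
    g xbar 0 i + (0 : 'rV[R]_m) 0 i.
  by apply: cvgD => //; exact: cvg_coord (cvg_trans (cvg_fmap2 Foo) uh0).
rewrite mxE addr0 in sum_cvg.
apply: filterS (cvgr_le _ sum_cvg _ gi0) => k; rewrite mxE; exact.
Unshelve. all: by end_near. Qed.

Lemma limit_feasible
    (F : set_system nat) (xbar : 'rV[R]_n) (a : 'rV[R]_m) (b : 'rV[R]_l) :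
  ProperFilter F -> F `=>` \oo ->
  g (x k) @[k --> F] --> g xbar -> h (x k) @[k --> F] --> h xbar ->
  mu k @[k --> F] --> a -> lam k @[k --> F] --> b ->
  feasible g h xbar.
Proof.
move=> FF Foo gx hx mua lamb.
have ups0' k : ups k != 0.
  by have [uk _] := run_gt0 k; rewrite gt_eqF.
have [gz0 h0] : (forall i, (g (x k) - z k) 0 i @[k --> F] --> 0) /\
    (forall j, h (x k) 0 j @[k --> F] --> 0).
  have [V0|[u0 um0 ul0]] := run_dichotomy.
    have {}V0 := cvg_trans (cvg_fmap2 Foo) V0.
    split=> i; apply: norm_cvg0; apply: (squeeze_cvgr _ (cvg_cst 0) V0);
      apply: nearW => k; rewrite normr_ge0/=;
      apply: le_trans (coord_le_enorm _ i) _;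
      by rewrite (run_V run) le_max lexx ?orbT.
  have {}u0 := cvg_trans (cvg_fmap2 Foo) u0.
  have {}um0 := cvg_trans (cvg_fmap2 Foo) um0.
  have {}ul0 := cvg_trans (cvg_fmap2 Foo) ul0.
  (* Convergence of the multipliers enters here: multiplied by the vanishing [ups k] they tend to
     0. *)
  have um : ups k *: mu k - ups k *: hmu k @[k --> F] --> 0 *: a - 0.
    by apply: cvgB => //; exact: cvgZ.
  have ul : ups k *: lam k - ups k *: hlam k @[k --> F] --> 0 *: b - 0.
    by apply: cvgB => //; exact: cvgZ.
  have gzE k : ups k *: mu k - ups k *: hmu k = g (x k) - z k.
    by rewrite (run_mu run) scalerDr scalerA divff// scale1r addrC addKr.
  have hE k : ups k *: lam k - ups k *: hlam k = h (x k).
    by rewrite (run_lam run) scalerDr scalerA divff// scale1r addrC addKr.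
  rewrite scale0r subr0 (funext gzE) in um.
  rewrite scale0r subr0 (funext hE) in ul.
  split=> i.
    have : (g (x k) - z k) 0 i @[k --> F] --> (0 : 'rV[R]_m) 0 i.
      exact: cvg_coord.
    by rewrite mxE.
  have : h (x k) 0 i @[k --> F] --> (0 : 'rV[R]_l) 0 i by exact: cvg_coord.
  by rewrite mxE.
split=> [i|].
  (* As [z k] is nonpositive, [g (x k)] is at most [g (x k) - z k], which tends to 0. *)
  apply: (ler_cvg_to (cvg_coord 0 i gx) (gz0 i)); apply: nearW => k.
  by rewrite (run_z run) !mxE lerBrDr gerDl ge_min lexx.
apply/rowP => j; rewrite [RHS]mxE.
exact: (cvg_unique (@norm_hausdorff _ _) (cvg_coord 0 j hx) (h0 j)).
Qed.

(** * Passing to the limit in the approximate stationarity condition *)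

Context (f : 'rV[R]_n -> R) (eps : nat -> R).
Context (Cf : C1_fun f) (Cg : C1_map g) (Ch : C1_map h).
Context (eps0 : eps k @[k --> \oo] --> 0).
Context (approx : forall k, enorm (gradient
    (fun y => aug_lagrangian f g h (ups k) y (hmu k) (hlam k)) (x k)) <= eps k).

(* The weight [sigma = 1] gives the stationarity conditions, and [sigma = 0] a
   certificate against extended MFCQ. *)
Lemma scaled_limit_conditions (F : set_system nat) (xbar : 'rV[R]_n)
    (s : nat -> R) (sigma : R) (a : 'rV[R]_m) (b : 'rV[R]_l) :
  ProperFilter F -> F `=>` \oo -> x k @[k --> F] --> xbar ->
  (\forall k \near F, 0 <= s k) -> s k @[k --> F] --> sigma ->
  s k *: mu k @[k --> F] --> a -> s k *: lam k @[k --> F] --> b ->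
  [/\ sigma *: gradient f xbar + a *m jac g xbar + b *m jac h xbar = 0,
      forall i, 0 <= a 0 i
    & forall i, g xbar 0 i < 0 -> a 0 i = 0].
Proof.
have [[df cf] [dg cg] [dh ch]] := And3 Cf Cg Ch.
move=> FF Foo xF s0 ssigma sa sb.
have gx : g (x k) @[k --> F] --> g xbar.
  exact: continuous_cvg (differentiable_continuous (dg xbar)) xF.
split.
- pose r k := gradient (fun y =>
    aug_lagrangian f g h (ups k) y (hmu k) (hlam k)) (x k).
  have r0 : r k @[k --> F] --> (0 : 'rV[R]_n).
    apply: cvg_mx => i j; rewrite mxE; apply: norm_cvg0.
    have epsF := cvg_trans (cvg_fmap2 Foo) eps0.
    apply: (squeeze_cvgr _ (cvg_cst 0) epsF); apply: nearW => k.
    rewrite normr_ge0 ord1/=; apply: le_trans (approx k).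
    exact: coord_le_enorm.
  have lim0 : s k *: r k @[k --> F] --> sigma *: (0 : 'rV[R]_n).
    exact: cvgZ.
  have rE k : s k *: r k = s k *: gradient f (x k) + s k *: mu k *m jac g (x k)
      + s k *: lam k *m jac h (x k).
    rewrite /r gradient_aug_lagrangian// -run_muE -run_lamE.
    by rewrite !scalerDr !scalemxAl.
  (* The scaled residual tends to 0, and by continuity of the derivatives also to the claimed
     combination; limits are unique. *)
  rewrite (funext rE) scaler0 in lim0.
  apply: (cvg_unique (@norm_hausdorff _ _) _ lim0).
  apply: cvgD; last first.
    by apply: cvg_mulmx => //; exact: continuous_cvg (ch xbar) xF.
  apply: cvgD; last first.
    by apply: cvg_mulmx => //; exact: continuous_cvg (cg xbar) xF.
  by apply: cvgZ => //; exact: continuous_cvg (cf xbar) xF.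
- move=> i.
  have sai : (s k *: mu k) 0 i @[k --> F] --> a 0 i by exact: cvg_coord.
  apply: (ler_cvg_to (cvg_cst 0) sai).
  apply: filterS s0 => k sk; have [uk _] := run_gt0 k.
  rewrite run_muE !mxE mulr_ge0// mulr_ge0 ?invr_ge0 ?(ltW uk)//.
  by rewrite le_max lexx.
- move=> i gi.
  have sai : (s k *: mu k) 0 i @[k --> F] --> a 0 i by exact: cvg_coord.
  apply: (cvg_unique (@norm_hausdorff _ _) sai).
  apply: cvg_near_cst; apply: filterS (inactive_multiplier_eq0 FF Foo gx gi).
  by move=> k muk; rewrite mxE muk mulr0.
Qed.

(** Serves both for stationarity of [xbar], along a filter obtained from boundedness, and for an
    arbitrary accumulation point of the multipliers. *)
Lemma limit_is_multiplier (F : set_system nat) (xbar : 'rV[R]_n)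
    (a : 'rV[R]_m) (b : 'rV[R]_l) :
  ProperFilter F -> F `=>` \oo -> x k @[k --> F] --> xbar ->
  mu k @[k --> F] --> a -> lam k @[k --> F] --> b ->
  feasible g h xbar /\ is_multiplier f g h xbar a b.
Proof.
move=> FF Foo xF mua lamb.
have [df _] := Cf; have [dg _] := Cg; have [dh _] := Ch.
have gx : g (x k) @[k --> F] --> g xbar.
  exact: continuous_cvg (differentiable_continuous (dg xbar)) xF.
have hx : h (x k) @[k --> F] --> h xbar.
  exact: continuous_cvg (differentiable_continuous (dh xbar)) xF.
have feas : feasible g h xbar := limit_feasible FF Foo gx hx mua lamb.
have [] := @scaled_limit_conditions F xbar (cst 1) 1 a b FF Foo xF.
- by apply: nearW => k; exact: ler01.
- exact: cvg_cst.
- by rewrite (_ : (fun k => _) = mu)//; apply/funext => k; rewrite scale1r.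
- by rewrite (_ : (fun k => _) = lam)//; apply/funext => k; rewrite scale1r.
rewrite scale1r => grad0 a0 inactive; split=> //; split=> //.
  by rewrite gradient_lagrangian.
(* By feasibility each constraint is either active or strictly negative; in the latter case its
   multiplier is 0. *)
rewrite /dot big1// => i _.
have [g0 _] := feas; have := g0 i.
rewrite le_eqVlt => /orP[/eqP ->|/inactive ->].
  by rewrite mulr0.
by rewrite mul0r.
Qed.

Lemma multipliers_bounded (K : set nat) (xbar : 'rV[R]_n) :
  extended_MFCQ g h xbar -> x k @[k --> within K \oo] --> xbar ->
  exists M, forall k, K k -> `|mu k| + `|lam k| <= M.
Proof.
move=> mfcq xK; apply: contrapT => unbounded.
pose t k := `|mu k| + `|lam k|.
have tK M : exists2 k, K k & M < t k.
  apply: contrapT => H; apply: unbounded; exists M => k Kk.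
  by rewrite leNgt; apply/negP => tk; apply: H; exists k.
have [F [FF KF tF]] := unbounded_subsequence tK.
have normalized_le1 d (v : nat -> 'rV[R]_d) : (forall k, `|v k| <= t k) ->
    \forall k \near F, `|(t k)^-1 *: v k| <= 1.
  move=> vt; apply: filterS (tF 0) => k tk.
  by rewrite normrZ ger0_norm ?invr_ge0 ?(ltW tk)// mulrC ler_pdivrMr// mul1r.
have mu_le k : `|mu k| <= t k by rewrite lerDl.
have lam_le k : `|lam k| <= t k by rewrite lerDr.
(* Two successive refinements, first for the normalized [mu], then for the normalized [lam]. *)
have [G [a [GF FG aG]]] := bounded_subfilter_cvg FF
  (normalized_le1 _ mu mu_le).
have [H [b [HF GH bH]]] := bounded_subfilter_cvg GF
  (FG _ (normalized_le1 _ lam lam_le)).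
have FH : F `<=` H := subset_trans FG GH.
have {}aG : (t k)^-1 *: mu k @[k --> H] --> a.
  exact: cvg_trans (cvg_fmap2 GH) aG.
have KH : within K \oo `<=` H := subset_trans KF FH.
have H_oo : H `=>` \oo by exact: cvg_trans KH (cvg_within _).
have {}xK : x k @[k --> H] --> xbar.
  by apply: cvg_trans xK; exact: cvg_fmap2.
have tV0 : (t k)^-1 @[k --> H] --> 0.
  apply/gtr0_cvgV0; first exact: FH (tF 0).
  by apply/cvgryPgt => M; exact: FH (tF M).
have tV_ge0 : \forall k \near H, 0 <= (t k)^-1.
  by apply: nearW => k; rewrite invr_ge0 addr_ge0.
(* The weights [(t k)^-1] tend to 0, so the gradient of [f] drops out of the limit. *)
have [] := scaled_limit_conditions HF H_oo xK tV_ge0 tV0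
  aG bH.
rewrite scale0r add0r => lin0 a0 inactive.
(* The norms of the normalized pair add up to 1 as soon as [t k] is positive; hence the limit pair
   is nonzero. *)
have norm1 : `|a| + `|b| = 1.
  have lim_norm : `|(t k)^-1 *: mu k| + `|(t k)^-1 *: lam k| @[k --> H] -->
      `|a| + `|b| by apply: cvgD; exact: cvg_norm.
  apply: (cvg_unique (@norm_hausdorff _ _) lim_norm).
  apply: cvg_near_cst; apply: filterS (FH _ (tF 0)) => k tk.
  by rewrite !normrZ -mulrDr ger0_norm ?invr_ge0 ?(ltW tk)// mulVf// gt_eqF.
apply: mfcq; exists a, b; split=> //.
  move=> [a_eq0 b_eq0]; move: norm1; rewrite a_eq0 b_eq0 !normr0 addr0.
  by move/esym/eqP; rewrite oner_eq0.
(* At a possibly infeasible [xbar], [min0] vanishes where [g] is nonnegative, and [a] vanishes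
   elsewhere. *)
rewrite /dot big1// => i _; rewrite mxE.
have [gi|/inactive ->] := leP 0 (g xbar 0 i); last by rewrite mul0r.
by rewrite mulr0.
Qed.

End SafeguardedRun.

(** * Boundedness, stationarity and accumulation points of the multipliers *)

Theorem theorem3p10 (R : realType) (n m l : nat)
    (f : 'rV[R]_n -> R) (g : 'rV[R]_n -> 'rV[R]_m) (h : 'rV[R]_n -> 'rV[R]_l)
    (Cf : C1_fun f) (Cg : C1_map g) (Ch : C1_map h)
    (ups0 : R) (Yg : set 'rV[R]_m) (Yh : set 'rV[R]_l) (tau gamma eta : R)
    (params : safeguard_params ups0 Yg Yh tau gamma eta)
    (eps : nat -> R) (eps_ge0 : forall k, 0 <= eps k)
    (eps_null : eps k @[k --> \oo] --> (0 : R))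
    (ups rho V : nat -> R) (x : nat -> 'rV[R]_n)
    (hmu mu z : nat -> 'rV[R]_m) (hlam lam : nat -> 'rV[R]_l)
    (run : safeguarded_AL_run g h ups0 Yg Yh tau gamma eta
             ups rho V x hmu mu z hlam lam)
    (approx : forall k,
       enorm (gradient
         (fun y => aug_lagrangian f g h (ups k) y (hmu k) (hlam k)) (x k))
       <= eps k)
    (xbar : 'rV[R]_n) (xbar_acc : cluster (x k @[k --> \oo]) xbar)
    (mfcq : extended_MFCQ g h xbar)
    (K : set nat) (K_inf : infinite_set K)
    (x_cvg : x k @[k --> within K \oo] --> xbar) :
  [/\ bounded_set [set (mu k, lam k) | k in K],
      stationary f g h xbar
    & forall (mu' : 'rV[R]_m) (lam' : 'rV[R]_l),
        cluster ((mu k, lam k) @[k --> within K \oo]) (mu', lam') ->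
        is_multiplier f g h xbar mu' lam'].
Proof.
have [M muM] := multipliers_bounded params run Cf Cg Ch eps_null approx mfcq
  x_cvg.
have KF := within_infinite_proper K_inf.
have K_oo : within K \oo `=>` \oo by exact: cvg_within.
have near_le d (v : nat -> 'rV[R]_d) :
    (forall k, `|v k| <= `|mu k| + `|lam k|) ->
    \forall k \near within K \oo, `|v k| <= M.
  by move=> vt; exists 0%N => // k _ Kk; exact: le_trans (vt k) (muM k Kk).
have mu_le k : `|mu k| <= `|mu k| + `|lam k| by rewrite lerDl.
have lam_le k : `|lam k| <= `|mu k| + `|lam k| by rewrite lerDr.
split.
- exists M; split; first exact: num_real.
  move=> N MN _ [k Kk <-]; apply: le_trans (ltW MN); apply: le_trans (muM k Kk).
  (* The norm of a pair is the maximum of the two norms, hence at most their sum. *)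
  by rewrite ge_max lerDl lerDr !normr_ge0.
- have [G [a [GF KG aG]]] := bounded_subfilter_cvg KF (near_le _ mu mu_le).
  have [H [b [HF GH bH]]] := bounded_subfilter_cvg GF
    (KG _ (near_le _ lam lam_le)).
  have KH := subset_trans KG GH.
  have H_oo : H `=>` \oo by exact: cvg_trans KH K_oo.
  have xH : x k @[k --> H] --> xbar := cvg_trans (cvg_fmap2 KH) x_cvg.
  have aH : mu k @[k --> H] --> a := cvg_trans (cvg_fmap2 GH) aG.
  have [feas mult] := limit_is_multiplier params run Cf Cg Ch eps_null approx
    HF H_oo xH aH bH.
  by split => //; exists a, b.
(* The pairs converge along a refinement [G]; projecting gives the limits of both components along
   the same filter. *)
- move=> mu' lam' /(cluster_comp KF)[G [GF KG pG]].
  have G_oo : G `=>` \oo by exact: cvg_trans KG K_oo.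
  have xG : x k @[k --> G] --> xbar := cvg_trans (cvg_fmap2 KG) x_cvg.
  have muG : mu k @[k --> G] --> mu'.
    exact: (cvg_comp (fun k => (mu k, lam k)) fst pG (cvg_fst (F := nbhs mu'))).
  have lamG : lam k @[k --> G] --> lam'.
    exact: (cvg_comp (fun k => (mu k, lam k)) snd pG (cvg_snd (F := nbhs mu'))).
  by have [] := limit_is_multiplier params run Cf Cg Ch eps_null approx
    GF G_oo xG muG lamG.
Qed.
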